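(* Let $\mathcal{H}$ be an infinite-dimensional separable Hilbert space and let $((f_n),(g_n))$ be a reproducing pair for $\mathcal{H}$. Then there are weights $(\lambda_n)\subset(0,\infty)$ and $(\beta_n)\subset(0,\infty)$ such that $(\frac{1}{\lambda_n}f_n)$ and $(\frac{1}{\beta_n}g_n)$ are lower semi frames for $\mathcal{H}$, and $(\lambda_ng_n)$ and $(\beta_nf_n)$ are upper semi-frames for $\mathcal{H}$. In particular, for every $A\in(0,\infty)$ there exist $(\omega_n)\subset(0,\infty)$ and $(\omega_n')\subset(0,\infty)$ such that $(\omega_nf_n)$ and $(\omega_n'g_n)$ are lower semi frames for $\mathcal{H}$ with bound $A$.
   Context: All sequences are indexed by $\mathbb{N}$. A pair of sequences $((f_n),(g_n))$ in $\mathcal{H}$ is a reproducing pair for $\mathcal{H}$ if the operator $T$ defined weakly by $\langle Tf,g\rangle=\sum_n\langle f,f_n\rangle\langle g_n,g\rangle$ for $f,g\in\mathcal{H}$ (the series converging for all $f,g\in\mathcal{H}$) is a bounded bijective operator from $\mathcal{H}$ onto $\mathcal{H}$. A sequence $(f_n)$ in $\mathcal{H}$ is a lower semi frame for $\mathcal{H}$ with bound $A>0$ if $A\|f\|^2\le\sum_n|\langle f,f_n\rangle|^2$ for all $f\in\mathcal{H}$ (the sum may be $+\infty$); it is a lower semi frame if this holds for some $A>0$. It is a Bessel sequence if there is $B\in(0,\infty)$ with $\sum_n|\langle f,f_n\rangle|^2\le B\|f\|^2$ for all $f\in\mathcal{H}$. It is complete in $\mathcal{H}$ if its linear span is dense in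 $\mathcal{H}$. An upper semi-frame for $\mathcal{H}$ is a Bessel sequence in $\mathcal{H}$ that is complete in $\mathcal{H}$. *)

(* Defs.v *)
From mathcomp Require Import all_boot all_order all_algebra.
From mathcomp Require Import sesquilinear complex.
From mathcomp Require Import all_classical all_reals all_analysis.
Import Order.TTheory GRing.Theory Num.Theory.
Import numFieldNormedType.Exports.

Set Implicit Arguments.
Unset Strict Implicit.
Unset Printing Implicit Defensive.

Local Open Scope classical_set_scope.
Local Open Scope ring_scope.

(* Hilbert spaces over the reals and over the complex numbers are treated
   simultaneously: k selects which of R and R[i] is the field of scalars. *)
Inductive scalar_kind := real_scalars | complex_scalars.

Definition scalars (R : realType) (k : scalar_kind) : numFieldType :=
  match k with
  | real_scalars => R
  | complex_scalars => R[i]%C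
  end.

Definition sconj (R : realType) (k : scalar_kind) :
    involutive_rmorphism (scalars R k) :=
  match k with
  | real_scalars => @idfun R
  | complex_scalars => @Num.conj (R[i]%C)
  end.

Definition of_real (R : realType) (k : scalar_kind) : R -> scalars R k :=
  match k with
  | real_scalars => fun x => x
  | complex_scalars => fun x => (x%:C)%C
  end.
Arguments of_real {R} k.

Definition re (R : realType) (k : scalar_kind) : scalars R k -> R :=
  match k with
  | real_scalars => fun x => x
  | complex_scalars => fun z => complex.Re z
  end.
Arguments re {R k}.

(* Norms of the library take their values in the field of scalars; these are
   the corresponding real numbers. *)
Definition modulus (R : realType) (k : scalar_kind) (z : scalars R k) : R :=
  re `|z|.

Definition rnorm (R : realType) (k : scalar_kind)
    (H : normedModType (scalars R k)) (x : H) : R := re `|x|.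

Section hilbert.
Context {R : realType} {k : scalar_kind}.
Local Notation K := (scalars R k).
Context {H : completeNormedModType K}.

(* The norm of H is the one given by ip, so that H is a Hilbert space;
   ip is linear in its first argument and conjugate-linear in its second. *)
Definition hilbert (ip : {dot H for sconj R k}) : Prop :=
  forall f : H, ip f f = `|f| ^+ 2.

Definition lspan (f : nat -> H) : set H :=
  [set x | exists (N : nat) (c : nat -> K), x = \sum_(n < N) c n *: f n].

Definition complete_seq (f : nat -> H) : Prop := dense (lspan f).

Definition weighted (w : nat -> R) (f : nat -> H) : nat -> H :=
  fun n => of_real k (w n) *: f n.

Variable ip : {dot H for sconj R k}.

Definition reproducing_pair (f g : nat -> H) : Prop :=
  exists T : {linear H -> H},
    [/\ forall x y : H,
          series (fun n => ip x (f n) * ip (g n) y) @ \oo --> (ip (T x) y : K),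
        exists M : R, forall x : H, rnorm (T x) <= M * rnorm x
      & bijective T].

Definition coef_energy (f : nat -> H) (x : H) : \bar R :=
  (\sum_(0 <= n <oo) ((modulus (ip x (f n)) ^+ 2)%:E))%E.

Definition lower_semi_frame_with_bound (A : R) (f : nat -> H) : Prop :=
  0 < A /\ forall x : H, ((A * rnorm x ^+ 2)%:E <= coef_energy f x)%E.

Definition lower_semi_frame (f : nat -> H) : Prop :=
  exists A : R, lower_semi_frame_with_bound A f.

Definition bessel (f : nat -> H) : Prop :=
  exists B : R, 0 < B /\
    forall x : H, (coef_energy f x <= (B * rnorm x ^+ 2)%:E)%E.

Definition upper_semi_frame (f : nat -> H) : Prop :=
  bessel f /\ complete_seq f.

End hilbert.

Definition separable (T : topologicalType) : Prop :=
  exists D : set T, countable D /\ dense D.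

Definition infinite_dimensional (F : fieldType) (V : lmodType F) : Prop :=
  ~ exists (n : nat) (e : 'I_n -> V),
      forall x : V, exists c : 'I_n -> F, x = \sum_(i < n) c i *: e i.

(* Main.v *)
(** The weights are [lambda_n = 2^-n / (1 + |g_n|)], which makes
    [(lambda_n g_n)] Bessel by Cauchy-Schwarz; it is complete because a vector
    orthogonal to every [g_n] is orthogonal to the range of [T]. Writing
    [<Tx, Tx>] as the series of [<x, f_n / lambda_n> <lambda_n g_n, Tx>] bounds
    [|Tx|^2] by a multiple of the energy of [x] with respect to
    [(f_n / lambda_n)], and [T] is bounded below because it is a bounded
    bijection. The other half is the same argument with [<Tx, y>] for
    [x = T^-1 y]. The lower bound for [T] comes from uniform boundedness applied
    to the vectors [y] with [|T* y| <= 1]. *)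

Require Import Defs.
From mathcomp Require Import all_boot all_order all_algebra.
From mathcomp Require Import sesquilinear complex.
From mathcomp Require Import all_classical all_reals all_analysis.
From mathcomp Require Import ring lra.
Import Order.TTheory GRing.Theory Num.Theory.
Import numFieldNormedType.Exports.

Local Open Scope classical_set_scope.
Local Open Scope ring_scope.

(** * Real parts, moduli and the embedding of the reals, uniformly in the two scalar fields *)

Section scalars.
Context {R : realType} {k : scalar_kind}.
Local Notation K := (scalars R k).
Implicit Types z w : K.

Lemma of_real_re z : 0 <= z -> of_real k (re z) = z.
Proof. by case: k z => //= z z0; apply: RRe_real; exact: ger0_real. Qed.

Lemma reK (a : R) : re (of_real k a) = a.
Proof. by case: k. Qed.

Lemma re0 : re (0 : K) = 0.
Proof. by case: k. Qed.

Lemma reD z w : re (z + w) = re z + re w.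
Proof. by case: k z w => //= -[? ?] [? ?]. Qed.

Lemma reN z : re (- z) = - re z.
Proof. by case: k z => //= -[? ?]. Qed.

Lemma le_re z w : z <= w -> re z <= re w.
Proof. by case: k z w => //= z w; rewrite lecE => /andP[]. Qed.

Lemma lt_re z w : z < w -> re z < re w.
Proof. by case: k z w => //= z w; rewrite ltcE => /andP[]. Qed.

Lemma of_realM (a b : R) : of_real k (a * b) = of_real k a * of_real k b.
Proof. by case: k => //=; rewrite rmorphM. Qed.

Lemma of_realD (a b : R) : of_real k (a + b) = of_real k a + of_real k b.
Proof. by case: k => //=; rewrite rmorphD. Qed.

Lemma of_real_gt0 (a : R) : (0 < of_real k a) = (0 < a).
Proof. by case: k => //=; rewrite ltcR. Qed.

Lemma lt_of_real (a b : R) : (of_real k a < of_real k b) = (a < b).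
Proof. by case: k => //=; rewrite ltcR. Qed.

Lemma of_real0 : of_real k 0 = 0 :> K.
Proof. by case: k. Qed.

Lemma of_real1 : of_real k 1 = 1 :> K.
Proof. by case: k. Qed.

Lemma sconj_of_real (a : R) : sconj R k (of_real k a) = of_real k a.
Proof. by case: k => //=; exact: conjc_real. Qed.

Lemma re_sconj z : re (sconj R k z) = re z.
Proof. by case: k z => //= -[]. Qed.

Lemma re_of_realM (a : R) z : re (of_real k a * z) = a * re z.
Proof. by case: k z => //= -[x y] /=; rewrite mul0r subr0. Qed.

Lemma modulusE z : `|z| = of_real k (modulus z).
Proof. by rewrite of_real_re. Qed.

Lemma of_real_inj : injective (of_real k : R -> K).
Proof. by move=> a b /(congr1 re); rewrite !reK. Qed.

Lemma modulus_ge0 z : 0 <= modulus z.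
Proof. by rewrite -re0; apply: le_re. Qed.

Lemma modulusM z w : modulus (z * w) = modulus z * modulus w.
Proof. by apply: of_real_inj; rewrite of_realM -!modulusE normrM. Qed.

Lemma modulusD z w : modulus (z + w) <= modulus z + modulus w.
Proof. by rewrite -reD; apply: le_re; exact: ler_normD. Qed.

Lemma modulusN z : modulus (- z) = modulus z.
Proof. by rewrite /modulus normrN. Qed.

Lemma modulus0 : modulus (0 : K) = 0.
Proof. by rewrite /modulus normr0 re0. Qed.

Lemma modulus_eq0 z : modulus z = 0 -> z = 0.
Proof. by move=> z0; apply/normr0_eq0; rewrite modulusE z0 of_real0. Qed.

Lemma modulus_of_real (a : R) : 0 <= a -> modulus (of_real k a) = a.
Proof.
move=> a0; rewrite /modulus ger0_norm ?reK//.
by case: k => //=; rewrite lecR.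
Qed.

Lemma modulus_sconj z : modulus (sconj R k z) = modulus z.
Proof. by case: k z => // z; exact: (congr1 (@complex.Re R) (norm_conjC z)). Qed.

Lemma mul_sconj z : z * sconj R k z = of_real k (modulus z ^+ 2).
Proof.
transitivity (`|z| ^+ 2); last by rewrite modulusE !expr2 of_realM.
case: k z => z; last by rewrite normCK.
by rewrite -normrX ger0_norm ?sqr_ge0// expr2.
Qed.

Lemma re_le_modulus z : re z <= modulus z.
Proof.
case: k z => /= z; first exact: ler_norm.
by apply: le_trans (ler_norm _) _; have := normc_ge_Re z; rewrite lecE => /andP[].
Qed.


(** Convergence with a real tolerance, so that the weak series defining [T] can be handled through
    its finite partial sums. *)
Lemma scalar_seriesP (u : nat -> K) (l : K) :
  series u @ \oo --> l ->
  forall e : R, 0 < e -> exists N, forall n, (N <= n)%N ->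
    modulus (\sum_(i < n) u i - l) < e.
Proof.
move=> /cvgrPdist_lt ul e e0.
have /ul : 0 < of_real k e by rewrite of_real_gt0.
case=> N _ uN; exists N => n /uN /lt_re; rewrite reK; apply: le_lt_trans.
by rewrite -modulusN opprB /series /= big_mkord.
Qed.

End scalars.

(** * The real-valued norm, density and completeness *)

Section norm.
Context {R : realType} {k : scalar_kind} {H : normedModType (scalars R k)}.
Implicit Types x y : H.

Lemma normE x : `|x| = of_real k (rnorm x).
Proof. by rewrite of_real_re. Qed.

Lemma rnorm_ge0 x : 0 <= rnorm x.
Proof. by rewrite -(@re0 R k); apply: le_re. Qed.

Lemma rnormD x y : rnorm (x + y) <= rnorm x + rnorm y.
Proof. by rewrite -reD; apply: le_re; exact: ler_normD. Qed.

Lemma rnormN x : rnorm (- x) = rnorm x.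
Proof. by rewrite /rnorm normrN. Qed.

Lemma rnormB x y : rnorm (x - y) = rnorm (y - x).
Proof. by rewrite -rnormN opprB. Qed.

Lemma rnorm0 : rnorm (0 : H) = 0.
Proof. by rewrite /rnorm normr0 re0. Qed.

Lemma rnormZ c x : rnorm (c *: x) = modulus c * rnorm x.
Proof.
by apply: (@of_real_inj _ k); rewrite of_realM -modulusE -!normE normrZ.
Qed.

Lemma rnorm_eq0 x : rnorm x = 0 -> x = 0.
Proof. by move=> x0; apply/normr0_eq0; rewrite normE x0 of_real0. Qed.

Lemma dense_rnorm (S : set H) :
  (forall x (e : R), 0 < e -> exists2 s, S s & rnorm (x - s) < e) -> dense S.
Proof.
move=> Sd O [x Ox] oO.
have /nbhs_normP[e /= e0 eO] : nbhs x O by exact: open_nbhs_nbhs.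
have [|s Ss xs] := Sd x (re e); first by rewrite -(@re0 R k); exact: lt_re.
exists s; split=> //; apply: eO => /=.
by rewrite -(of_real_re _ (ltW e0)) normE lt_of_real.
Qed.

End norm.

Lemma rnorm_cauchy_cvg (R : realType) (k : scalar_kind)
    (H : completeNormedModType (scalars R k)) (u : nat -> H) :
  (forall e : R, 0 < e -> exists N, forall n m, (N <= n)%N -> (N <= m)%N ->
    rnorm (u n - u m) < e) ->
  exists l : H, forall e : R, 0 < e -> exists N, forall n, (N <= n)%N ->
    rnorm (u n - l) < e.
Proof.
move=> uC.
have /cvg_ex[l /cvgrPdist_lt ul] : cvg (u @ \oo).
  apply: cauchy_cvg; apply: cauchy_exP => e e0.
  have [|N uN] := uC (re e); first by rewrite -(@re0 R k); exact: lt_re.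
  exists (u N); exists N => // n Nn.
  rewrite -ball_normE /= -(of_real_re _ (ltW e0)) normE lt_of_real.
  exact: uN.
exists l => e e0.
have /ul : 0 < of_real k e by rewrite of_real_gt0.
by case=> N _ uN; exists N => n /uN /lt_re; rewrite reK rnormB.
Qed.


(** Approximation arguments produce errors [e * c] with [c] fixed. Dividing the tolerance by
    [|c| + 1] covers every sign of [c], zero included. *)
Lemma le_of_le_addM (R : realFieldType) (a b c : R) :
  (forall e, 0 < e -> a <= b + e * c) -> a <= b.
Proof.
move=> abc; apply/ler_addgt0Pr => e e0.
have c0 : 0 < `|c| + 1 by rewrite ltr_wpDl.
apply: le_trans (abc (e / (`|c| + 1)) _) _; first by rewrite divr_gt0.
rewrite lerD2l -mulrA ger_pMr// mulrC ler_pdivrMr// mul1r.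
by apply: le_trans (ler_norm c) _; rewrite lerDl.
Qed.

(** * Hilbert space geometry: Cauchy-Schwarz, Riesz representation, uniform boundedness, density of
    spans *)

Section hilbert_theory.
Context {R : realType} {k : scalar_kind}.
Local Notation K := (scalars R k).
Context {H : completeNormedModType K} {ip : {dot H for sconj R k}}.
Hypothesis hH : hilbert ip.
Implicit Types (x y z : H) (c : K).

Lemma ipDl x y z : ip (x + y) z = ip x z + ip y z.
Proof. exact: linearDl. Qed.

Lemma ipBl x y z : ip (x - y) z = ip x z - ip y z.
Proof. exact: linearBl. Qed.

Lemma ipZl c x y : ip (c *: x) y = c * ip x y.
Proof. exact: linearZl_LR. Qed.

Lemma ipDr x y z : ip z (x + y) = ip z x + ip z y.
Proof. exact: linearDr. Qed.

Lemma ipBr x y z : ip z (x - y) = ip z x - ip z y.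
Proof. exact: linearBr. Qed.

Lemma ipZr c x y : ip x (c *: y) = sconj R k c * ip x y.
Proof. exact: linearZr_LR. Qed.

Lemma ipC x y : ip x y = sconj R k (ip y x).
Proof. by rewrite hermC expr0 mul1r. Qed.

Lemma re_ipC x y : re (ip x y) = re (ip y x).
Proof. by rewrite ipC re_sconj. Qed.

Lemma modulus_ipC x y : modulus (ip x y) = modulus (ip y x).
Proof. by rewrite ipC modulus_sconj. Qed.

Lemma ipxx x : ip x x = of_real k (rnorm x ^+ 2).
Proof. by rewrite hH normE !expr2 of_realM. Qed.

Lemma ip0r x : ip x 0 = 0.
Proof. exact: linear0r. Qed.

Lemma rnorm_sqrD x y :
  rnorm (x + y) ^+ 2 = rnorm x ^+ 2 + 2 * re (ip x y) + rnorm y ^+ 2.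
Proof.
rewrite -[LHS](@reK R k) -ipxx ipDl !ipDr !reD !ipxx !reK (re_ipC y x).
by ring.
Qed.

Lemma rnorm_sqrB x y :
  rnorm (x - y) ^+ 2 = rnorm x ^+ 2 - 2 * re (ip x y) + rnorm y ^+ 2.
Proof.
by rewrite rnorm_sqrD rnormN -[- y]sub0r ipBr ip0r sub0r reN mulrN.
Qed.

Lemma ip_ext x y : (forall z, ip z x = ip z y) -> x = y.
Proof.
move=> xy; apply/eqP; rewrite -subr_eq0; apply/eqP/rnorm_eq0/eqP.
rewrite -sqrf_eq0 -(reK (rnorm _ ^+ 2) : @re R k _ = _).
by rewrite -ipxx ipBr xy subrr re0.
Qed.

Lemma cauchy_schwarz x y : modulus (ip x y) <= rnorm x * rnorm y.
Proof.
have [->|y0] := eqVneq y 0; first by rewrite ip0r modulus0 rnorm0 mulr0.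
have y1 : 0 < rnorm y.
  rewrite lt_neqAle rnorm_ge0 andbT eq_sym.
  by apply: contraNneq y0 => /rnorm_eq0 ->.
rewrite -ler_sqr ?nnegrE ?mulr_ge0 ?modulus_ge0 ?rnorm_ge0// exprMn.
(* [a * ip x y] is the coefficient of the orthogonal projection of [x] on the line of [y]. The
   squared distance to that projection, multiplied by [rnorm y ^+ 2], gives the inequality. *)
pose a := rnorm y ^-2.
have := sqr_ge0 (rnorm (x - (of_real k a * ip x y) *: y)).
rewrite rnorm_sqrB rnormZ ipZr rmorphM /= sconj_of_real modulusM.
have a0 : 0 < a by rewrite invr_gt0 exprn_gt0.
rewrite (modulus_of_real _ (ltW a0)) -mulrA re_of_realM [_ * ip x y]mulrC.
rewrite mul_sconj reK.
have ay : a * rnorm y ^+ 2 = 1 by rewrite mulVf// expf_neq0 ?gt_eqF.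
set p := modulus _; set X := rnorm x => h.
have := mulr_ge0 (sqr_ge0 (rnorm y)) h.
have -> : rnorm y ^+ 2 *
   (X ^+ 2 - 2 * (a * p ^+ 2) + (a * p * rnorm y) ^+ 2) =
   X ^+ 2 * rnorm y ^+ 2 - 2 * (a * rnorm y ^+ 2) * p ^+ 2 +
   (a * rnorm y ^+ 2) ^+ 2 * p ^+ 2 by ring.
by rewrite ay; lra.
Qed.


(** The vector [u] is the limit of a minimizing sequence in [M] of the quadratic functional [J]
    below. As [M] is not assumed closed, [u] is only located in its closure. With [phi] equal to
    [ip _ x], it is the orthogonal projection of [x] on that closure. *)
Lemma riesz_on_subspace (M : set H) (phi : H -> K) (B : R) :
  M 0 ->
  (forall c x y, M x -> M y -> M (c *: x + y)) ->
  (forall c x y, phi (c *: x + y) = c * phi x + phi y) ->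
  (forall x, modulus (phi x) <= B * rnorm x) ->
  exists u, (forall e : R, 0 < e -> exists2 s, M s & rnorm (u - s) < e) /\
            (forall x, M x -> phi x = ip x u).
Proof.
move=> M0 Mlin philin phiB.
pose J z := rnorm z ^+ 2 - 2 * re (phi z).
have phiD x y : phi (x + y) = phi x + phi y.
  by rewrite -{1}[x]scale1r philin mul1r.
have phi0 : phi 0 = 0.
  by apply/eqP; rewrite -[_ == _](inj_eq (addrI (phi 0))) addr0 -phiD addr0.
have phiZ c x : phi (c *: x) = c * phi x.
  by rewrite -[c *: x]addr0 philin phi0 addr0.
have Jinf : has_inf [set J z | z in M].
  split; first by exists (J 0), 0.
  (* Completing the square in [rnorm z ^+ 2 - 2 * B * rnorm z] gives this lower bound. *)
  exists (- B ^+ 2) => _ [z Mz <-].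
  have := le_trans (re_le_modulus (phi z)) (phiB z).
  by have := sqr_ge0 (rnorm z - B); rewrite /J; nra.
pose d := inf [set J z | z in M].
have dJ z : M z -> d <= J z.
  by move=> Mz; apply: ge_inf; [exact: Jinf.2|exists z].
have /choice[zs zsP] : forall n : nat, exists z, M z /\ J z < d + n.+1%:R^-1.
  move=> n; have n0 : 0 < n.+1%:R^-1 :> R by rewrite invr_gt0.
  by have [_ [z Mz <-] Jz] := inf_adherent n0 Jinf; exists z.
(* For the midpoint [m], the parallelogram law reads [rnorm (a - b) ^+ 2 = 2 * J a + 2 * J b - 4 * J
   m], since the linear part of [J] cancels; and [J m] is at least [d]. *)
have parallelogram a b : M a -> M b ->
    rnorm (a - b) ^+ 2 <= 2 * (J a - d) + 2 * (J b - d).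
  move=> Ma Mb; pose m := of_real k 2^-1 *: (a + b).
  have Mm : M m.
    rewrite /m -[_ *: _]addr0; apply: (Mlin) => //.
    by rewrite -[a]scale1r; exact: Mlin.
  have := dJ _ Mm; rewrite /J /m rnormZ modulus_of_real ?invr_ge0 ?ler0n//.
  rewrite phiZ phiD re_of_realM reD exprMn rnorm_sqrB rnorm_sqrD.
  by lra.
have small (e : R) : 0 < e -> exists N, forall n, (N <= n)%N -> n.+1%:R^-1 < e.
  move=> e0; exists (Num.truncn e^-1) => n Nn.
  rewrite -[e]invrK ltf_pV2 ?posrE ?invr_gt0 ?ltr0n//.
  apply: lt_le_trans (truncnS_gt _) _.
  by rewrite ler_nat ltnS.
have [u uP] : exists u, forall e : R, 0 < e -> exists N, forall n, (N <= n)%N ->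
    rnorm (zs n - u) < e.
  apply: rnorm_cauchy_cvg => e e0.
  have [|N NP] := small (e ^+ 2 / 4); first by rewrite divr_gt0 ?exprn_gt0.
  exists N => n m /NP Nn /NP Nm.
  rewrite -ltr_sqr ?nnegrE ?rnorm_ge0 ?(ltW e0)//.
  have [Mn Jn] := zsP n; have [Mm Jm] := zsP m.
  have := parallelogram _ _ Mn Mm.
  move: Jn Jm Nn Nm; set i := n.+1%:R^-1; set j := m.+1%:R^-1.
  by clearbody d i j; lra.
exists u; split=> [e /uP[N uN]|m Mm].
  by exists (zs N); [exact: (zsP N).1|rewrite rnormB uN].
(* A near-minimizer almost satisfies the Euler equation. Moving [z] by [t *: m] changes [J] by
   [- 2 * s * p ^+ 2 + s ^+ 2 * w * p ^+ 2], where [p] is the modulus of [r], and this is at least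
   [- e]. Taking [s] as the inverse of [1 + w], not of [w], also covers [m = 0]. *)
have variation (e : R) z : M z -> J z <= d + e ->
    modulus (phi m - ip m z) ^+ 2 <= e * (1 + rnorm m ^+ 2).
  move=> Mz Jz; set r := phi m - ip m z.
  pose w := rnorm m ^+ 2.
  have w0 : 0 < 1 + w by rewrite ltr_pwDl ?sqr_ge0.
  pose s := (1 + w)^-1; have s0 : 0 < s by rewrite invr_gt0.
  have sw : s * (1 + w) = 1 by rewrite mulVf ?gt_eqF.
  pose t := of_real k s * sconj R k r.
  have := dJ _ (Mlin t _ _ Mm Mz); rewrite /J rnorm_sqrD philin ipZl reD rnormZ.
  have -> : re (t * phi m) = re (t * ip m z) + s * modulus r ^+ 2.
    rewrite -[phi m](subrK (ip m z)) -/r mulrDr reD addrC; congr (_ + _).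
    by rewrite /t -mulrA [_ * r]mulrC mul_sconj re_of_realM reK.
  rewrite /t modulusM (modulus_of_real _ (ltW s0)) modulus_sconj exprMn -/w.
  move: Jz; rewrite /J; set p := modulus r; move=> Jz h.
  have {h} : s * p ^+ 2 <= e.
    have : s * (s * w) * p ^+ 2 = s * p ^+ 2 - s ^+ 2 * p ^+ 2.
      by rewrite (_ : s * w = 1 - s); [ring|rewrite -sw; ring].
    have : 0 <= s ^+ 2 * p ^+ 2 by rewrite mulr_ge0 ?sqr_ge0.
    by move: h; rewrite exprMn; lra.
  by move=> /(ler_wpM2r (ltW w0)); rewrite mulrAC sw mul1r.
apply/eqP; rewrite -subr_eq0; apply/eqP/modulus_eq0/eqP.
rewrite eq_le modulus_ge0 andbT.
(* One [e] comes from [variation] at [zs n], and [e * rnorm m] from replacing [u] by [zs n] through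
   Cauchy-Schwarz. *)
apply: (@le_of_le_addM _ _ _ (1 + rnorm m)) => e e0; rewrite add0r.
pose w := rnorm m ^+ 2.
have w0 : 0 < 1 + w by rewrite ltr_pwDl ?sqr_ge0.
have [|N NP] := small (e ^+ 2 / (1 + w)).
  by rewrite divr_gt0 ?exprn_gt0.
have [N1 N1P] := uP e e0.
pose n := maxn N N1.
have [Mn Jn] := zsP n.
have [Nn N1n] : (N <= n)%N /\ (N1 <= n)%N by rewrite leq_maxl leq_maxr.
have vn : modulus (phi m - ip m (zs n)) <= e.
  rewrite -ler_sqr ?nnegrE ?modulus_ge0 ?(ltW e0)//.
  have -> : e ^+ 2 = e ^+ 2 / (1 + w) * (1 + w) by rewrite divfK ?gt_eqF.
  apply: variation => //.
  by apply/ltW/(lt_trans Jn); rewrite ltrD2l; exact: NP.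
have -> : phi m - ip m u = (phi m - ip m (zs n)) + ip m (zs n - u).
  by rewrite ipBr addrA subrK.
apply: le_trans (modulusD _ _) _.
rewrite mulrDr mulr1 lerD// mulrC; apply: le_trans (cauchy_schwarz _ _) _.
by rewrite ler_wpM2l ?rnorm_ge0 ?(ltW (N1P _ N1n)).
Qed.


(** Take [v] of norm [r] along [y]. The values of [ip _ y] at [x + v] and [x - v] differ by
    [2 * r * rnorm y] in modulus, so they cannot both be smaller than half of that. *)
Lemma ip_large_in_ball x y (r : R) : 0 <= r ->
  exists x', rnorm (x' - x) <= r /\ r * rnorm y <= modulus (ip x' y).
Proof.
move=> r0; have [->|y0] := eqVneq y 0.
  by exists x; rewrite subrr rnorm0 mulr0 modulus_ge0.
have y1 : 0 < rnorm y.
  rewrite lt_neqAle rnorm_ge0 andbT eq_sym.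
  by apply: contraNneq y0 => /rnorm_eq0 ->.
pose v := of_real k (r / rnorm y) *: y.
have ry : 0 <= r / rnorm y by rewrite divr_ge0 // ltW.
have nv : rnorm v = r by rewrite rnormZ modulus_of_real// divfK ?gt_eqF.
have vy : modulus (ip v y) = r * rnorm y.
  rewrite ipZl ipxx modulusM !modulus_of_real// ?sqr_ge0//.
  by rewrite expr2 mulrA divfK ?gt_eqF.
have : 2 * (r * rnorm y) <= modulus (ip (x + v) y) + modulus (ip (x - v) y).
  rewrite -vy -[X in _ + X]modulusN; apply: le_trans (modulusD _ _).
  have -> : ip (x + v) y - ip (x - v) y = of_real k 2 * ip v y.
    by rewrite ipDl ipBl -[2]/(1 + 1) of_realD of_real1; ring.
  by rewrite modulusM modulus_of_real.
have [h _|h h'] := leP (r * rnorm y) (modulus (ip (x + v) y)).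
  by exists (x + v); rewrite addrAC subrr add0r nv.
exists (x - v); rewrite addrAC subrr add0r rnormN nv; split=> //.
by move: h h'; lra.
Qed.

(* Gliding hump: perturbations of size [3^-n], chosen so as to make
   [<x, y_n>] large at step [n], cannot be undone by the later ones, whose
   total size is at most [3^-n / 2]. *)
Lemma uniform_boundedness (Y : set H) :
  (forall x, exists B : R, forall y, Y y -> modulus (ip x y) <= B) ->
  exists2 C : R, 0 < C & forall y, Y y -> rnorm y <= C.
Proof.
move=> Ybd; apply: contrapT => nbd.
pose q n : R := 3^-1 ^+ n.
have q0 n : 0 < q n by rewrite exprn_gt0 ?invr_gt0.
have qS n : q n = 3 * q n.+1 by rewrite /q exprS mulrA divff ?mul1r.
(* The factor 2 is there because later perturbations can cancel up to half of the hump. *)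
have /choice[y yP] n : exists y, Y y /\ 2 * n%:R < q n * rnorm y.
  apply: contrapT => ny; apply: nbd.
  exists (2 * n%:R / q n + 1); first by rewrite ltr_wpDl// divr_ge0// ltW.
  move=> y Yy; rewrite leNgt; apply/negP => yl; apply: ny; exists y; split=> //.
  rewrite [q n * _]mulrC -ltr_pdivrMr//; apply: lt_trans yl.
  by rewrite ltrDl.
have /choice[F FP] (nx : nat * H) : exists x',
    rnorm (x' - nx.2) <= q nx.1 /\ q nx.1 * rnorm (y nx.1) <= modulus (ip x' (y nx.1)).
  by apply: ip_large_in_ball; rewrite ltW.
pose fix x n := if n is n'.+1 then F (n', x n') else 0.
have xP n : rnorm (x n.+1 - x n) <= q n /\
            q n * rnorm (y n) <= modulus (ip (x n.+1) (y n)).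
  exact: (FP (n, x n)).
(* The right-hand side is the exact geometric sum of [q n], ..., [q (n + p - 1)], a form that passes
   through the induction. *)
have tail n p : rnorm (x (n + p)%N - x n) <= 3 / 2 * (q n - q (n + p)%N).
  elim: p => [|p IH]; first by rewrite addn0 !subrr rnorm0 mulr0.
  rewrite addnS -(subrK (x (n + p)%N) (x _)) -addrA.
  apply: le_trans (rnormD _ _) _.
  have [+ _] := xP (n + p)%N; have := qS (n + p)%N.
  by move: IH; lra.
have tail' n m : (n <= m)%N -> rnorm (x m - x n) <= 3 / 2 * q n.
  move=> /subnKC <-; apply: le_trans (tail _ _) _.
  by have := q0 (n + (m - n))%N; lra.
have q_small (e : R) : 0 < e -> exists N, forall n, (N <= n)%N -> q n < e.
  move=> e0; have : q n @[n --> \oo] --> 0.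
    by apply: cvg_expr; rewrite ger0_norm ?invf_lt1 ?ltr1n ?invr_ge0.
  move=> /cvgrPdist_lt/(_ e e0)[N _ NP]; exists N => n /NP.
  by rewrite sub0r normrN ger0_norm ?ltW.
have [l lP] : exists l, forall e : R, 0 < e -> exists N, forall n, (N <= n)%N ->
    rnorm (x n - l) < e.
  apply: rnorm_cauchy_cvg => e e0.
  have [|N NP] := q_small (e / 4); first by rewrite divr_gt0.
  exists N => n m Nn Nm; rewrite -(subrK (x N) (x n)) -addrA.
  apply: le_lt_trans (rnormD _ _) _.
  rewrite (rnormB (x N)).
  have := tail' _ _ Nn; have := tail' _ _ Nm; have := NP N (leqnn _).
  by lra.
have ltail n : rnorm (l - x n) <= 3 / 2 * q n.
  apply: (@le_of_le_addM _ _ _ 1) => e /lP[N NP].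
  pose m := maxn n N.
  rewrite -(subrK (x m) l) -addrA mulr1; apply: le_trans (rnormD _ _) _.
  have := tail' _ _ (leq_maxl n N); have := NP _ (leq_maxr n N).
  by rewrite -/m (rnormB l); lra.
have [B BP] := Ybd l.
have [n nB] : exists n : nat, B < n%:R.
  by exists (Num.truncn B).+1; exact: truncnS_gt.
have [Yy yn] := yP n; have [_ hump] := xP n.
have := BP _ Yy.
(* The distance from [x n.+1] to [l] is at most [3 / 2 * q n.+1], which is [q n / 2]. Hence at least
   half of the hump survives at [l], and it exceeds [n], hence [B]. *)
have : modulus (ip (x n.+1) (y n)) <=
    modulus (ip l (y n)) + 2^-1 * (q n * rnorm (y n)).
  rewrite -(subrK l (x n.+1)) ipDl addrC.
  apply: le_trans (modulusD _ _) _; rewrite lerD2l.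
  apply: le_trans (cauchy_schwarz _ _) _.
  rewrite mulrA ler_wpM2r ?rnorm_ge0// rnormB.
  by have := ltail n.+1; rewrite (qS n); lra.
by lra.
Qed.

(* [T*] is bounded below by uniform boundedness, because [<x, y>] equals
   [<T^-1 x, T* y>]; as [T*] has dense range, this passes to [T]. *)
Lemma bijective_bounded_below (T : {linear H -> H}) (M : R) :
  (forall x, rnorm (T x) <= M * rnorm x) -> bijective T ->
  exists2 C : R, 0 < C & forall x, rnorm x <= C * rnorm (T x).
Proof.
move=> TM [S TS ST].
(* The adjoint is kept as a relation between [y] and [z], with no operator built. *)
have adjoint y : exists z, forall x, ip (T x) y = ip x z.
  have [||||z [_ zP]] := @riesz_on_subspace setT (fun x => ip (T x) y) (M * rnorm y).
  - by [].
  - by [].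
  - by move=> c u v; rewrite linearP ipDl ipZl.
  - move=> x; apply: le_trans (cauchy_schwarz _ _) _.
    by rewrite mulrAC ler_wpM2r ?rnorm_ge0.
  by exists z => x; exact: zP.
have [C C0 CP] : exists2 C : R, 0 < C & forall y,
    [set y | exists2 z, rnorm z <= 1 & forall x, ip (T x) y = ip x z] y ->
    rnorm y <= C.
  apply: uniform_boundedness => x; exists (rnorm (S x)) => y [z z1 yz].
  rewrite -{1}(ST x) yz; apply: le_trans (cauchy_schwarz _ _) _.
  by rewrite ler_piMr ?rnorm_ge0.
have adjoint_below y z : (forall x, ip (T x) y = ip x z) -> rnorm y <= C * rnorm z.
  move=> yz; have [z0|z0] := eqVneq (rnorm z) 0.
    have -> : y = 0.
      by apply: ip_ext => x; rewrite -(ST x) yz (rnorm_eq0 _ z0) !ip0r.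
    by rewrite rnorm0 mulr_ge0 ?rnorm_ge0 ?ltW.
  have z1 : 0 < rnorm z by rewrite lt_neqAle rnorm_ge0 eq_sym z0.
  pose c := of_real k (rnorm z)^-1.
  have cE : modulus c = (rnorm z)^-1 by rewrite modulus_of_real ?invr_ge0 ?ltW.
  have := CP (c *: y); rewrite rnormZ cE mulrC ler_pdivrMr//; apply.
  exists (c *: z); first by rewrite rnormZ cE mulVf.
  by move=> x; rewrite !ipZr yz.
exists C => // x.
(* Let [u] be the projection of [x] on the closure of the range of the adjoint. Then [x - u] is
   orthogonal to that range, so [T (x - u)] is orthogonal to every vector, and [x = u] by
   injectivity. *)
have dense_range (e : R) : 0 < e -> exists2 z,
    (exists y, forall x, ip (T x) y = ip x z) & rnorm (x - z) < e.
  have [||||u [uM uP]] := @riesz_on_subspace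
    [set z | exists y, forall x, ip (T x) y = ip x z] (fun z => ip z x) (rnorm x).
  - by exists 0 => z; rewrite !ip0r.
  - move=> c z1 z2 [y1 h1] [y2 h2]; exists (c *: y1 + y2) => z.
    by rewrite !ipDr !ipZr h1 h2.
  - by move=> c z1 z2; rewrite ipDl ipZl.
  - by move=> z; rewrite mulrC; exact: cauchy_schwarz.
  suff -> : x = u by exact: uM.
  apply: (can_inj TS); apply/eqP; rewrite -subr_eq0 -linearB; apply/eqP.
  apply: ip_ext => y.
  rewrite ip0r ipC; have [z yz] := adjoint y.
  rewrite yz ipC ipBr uP ?subrr ?rmorph0//.
  by exists y.
have [x0|x0] := eqVneq (rnorm x) 0.
  by rewrite x0 mulr_ge0 ?rnorm_ge0// ltW.
have x1 : 0 < rnorm x by rewrite lt_neqAle rnorm_ge0 eq_sym x0.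
rewrite -(ler_pM2r x1) -expr2.
(* With [z] the adjoint image of [y] and within [e] of [x], split [ip x x] into
   [ip x z = ip (T x) y] and [ip x (x - z)]. Since [rnorm y] is at most [C * (rnorm x + e)], the two
   errors add up to this multiple of [e]. *)
apply: (@le_of_le_addM _ _ _ (C * rnorm (T x) + rnorm x)) => e e0.
have [z [y yz] xz] := dense_range e e0.
have zx : rnorm z <= rnorm x + e.
  rewrite -(subrK x z); apply: le_trans (rnormD _ _) _.
  by rewrite addrC lerD2l rnormB ltW.
have -> : rnorm x ^+ 2 = re (ip (T x) y) + re (ip x (x - z)).
  by rewrite yz -reD -ipDr addrC subrK ipxx reK.
have h1 : re (ip (T x) y) <= rnorm (T x) * (C * (rnorm x + e)).
  apply: le_trans (re_le_modulus _) _; apply: le_trans (cauchy_schwarz _ _) _.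
  rewrite ler_wpM2l ?rnorm_ge0//; apply: le_trans (adjoint_below _ _ yz) _.
  by rewrite ler_wpM2l// ltW.
have h2 : re (ip x (x - z)) <= rnorm x * e.
  apply: le_trans (re_le_modulus _) _; apply: le_trans (cauchy_schwarz _ _) _.
  by rewrite ler_wpM2l ?rnorm_ge0// ltW.
apply: le_trans (lerD h1 h2) _.
by rewrite le_eqVlt; apply/orP; left; apply/eqP; ring.
Qed.

(** If [u] is the projection of [x] on the closed span, then [x - u] is orthogonal to every [f n],
    hence zero, so [x] is a limit of elements of the span. *)
Lemma complete_seq_total (f : nat -> H) :
  (forall x, (forall n, ip x (f n) = 0) -> x = 0) -> complete_seq f.
Proof.
move=> f0; apply: dense_rnorm => x.
have fspan n : lspan f (f n).
  exists n.+1, (fun i => (i == n)%:R); rewrite big_ord_recr/= eqxx scale1r.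
  by rewrite big1 ?add0r// => i _; rewrite ltn_eqF ?scale0r.
have [||||u [uM uP]] := @riesz_on_subspace (lspan f) (fun z => ip z x) (rnorm x).
- by exists 0%N, (fun=> 0); rewrite big_ord0.
- move=> c y z [N1 [c1 ->]] [N2 [c2 ->]].
  have widen N m (d : nat -> K) : (N <= m)%N ->
      \sum_(n < N) d n *: f n = \sum_(n < m) (if (n < N)%N then d n else 0) *: f n.
    move=> Nm; rewrite (big_ord_widen m (fun n => d n *: f n))// big_mkcond/=.
    by apply: eq_bigr => i _; case: ifP => // _; rewrite scale0r.
  pose m := maxn N1 N2.
  rewrite (widen N1 m c1) ?leq_maxl// (widen N2 m c2) ?leq_maxr//.
  exists m, (fun n => c * (if (n < N1)%N then c1 n else 0) +
                      (if (n < N2)%N then c2 n else 0)).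
  rewrite scaler_sumr -big_split/=; apply: eq_bigr => i _.
  by rewrite scalerDl scalerA.
- by move=> c y z; rewrite ipDl ipZl.
- by move=> z; rewrite mulrC; exact: cauchy_schwarz.
suff -> : x = u by exact: uM.
apply/eqP; rewrite -subr_eq0; apply/eqP/f0 => n.
by rewrite ipC ipBr uP// subrr rmorph0.
Qed.

End hilbert_theory.

(** * Series of nonnegative reals and a weighted duality estimate *)

Section nonneg_series.
Context {R : realType}.
Implicit Types u p q w : nat -> R.

Lemma nneseries_fin_le u (r : R) : (forall n, 0 <= u n) ->
  (\sum_(0 <= n <oo) (u n)%:E <= r%:E)%E <-> forall N, \sum_(i < N) u i <= r.
Proof.
move=> u0; split=> [ur N|ur].
  rewrite -lee_fin -sumEFin -(big_mkord xpredT (fun i => (u i)%:E)).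
  by apply: le_trans ur; apply: nneseries_lim_ge => n _; rewrite lee_fin.
apply: lime_le.
  by apply: is_cvg_nneseries => n _ _; rewrite lee_fin.
by apply: nearW => N; rewrite big_mkord sumEFin lee_fin.
Qed.

(* AM-GM: [2 p q <= D (p / w)^2 + (w q)^2 / D]; the choice of [D] lets the
   second sum be absorbed by the left-hand side. *)
Lemma weighted_duality p q w (l D : R) : (forall n, 0 < w n) -> 0 < D ->
  (forall e, 0 < e -> exists N, l <= \sum_(i < N) p i * q i + e) ->
  (\sum_(0 <= n <oo) ((w n * q n) ^+ 2)%:E <= (D * l)%:E)%E ->
  ((D^-1 * l)%:E <= \sum_(0 <= n <oo) (((w n)^-1 * p n) ^+ 2)%:E)%E.
Proof.
move=> w0 D0 lP /nneseries_fin_le wq.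
have := @nneseries_ge0 R (fun n => (((w n)^-1 * p n) ^+ 2)%:E) xpredT 0.
case E: (\sum_(0 <= n <oo) _)%E => [r| |] pos; last 2 first.
- by rewrite leey.
- by have := pos (fun n _ _ => sqr_ge0 _).
rewrite lee_fin mulrC ler_pdivrMr//.
have /nneseries_fin_le wp : (\sum_(0 <= n <oo) (((w n)^-1 * p n) ^+ 2)%:E <= r%:E)%E.
  by rewrite E.
suff : l <= 2^-1 * (D * r + l) by lra.
apply/ler_addgt0Pr => e /lP[N lN]; apply: le_trans lN _; rewrite lerD2r.
have -> : \sum_(i < N) p i * q i = \sum_(i < N) ((w i)^-1 * p i) * (w i * q i).
  by apply: eq_bigr => i _; rewrite mulrACA mulVf ?gt_eqF// mul1r.
have amgm i : ((w i)^-1 * p i) * (w i * q i) <=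
    2^-1 * (D * ((w i)^-1 * p i) ^+ 2 + D^-1 * (w i * q i) ^+ 2).
  set a := _^-1 * _; set b := w i * _.
  have : 0 <= D^-1 * (D * a - b) ^+ 2 by rewrite mulr_ge0 ?sqr_ge0 ?invr_ge0 ?ltW.
  have -> : D^-1 * (D * a - b) ^+ 2 = D * a ^+ 2 - 2 * (a * b) + D^-1 * b ^+ 2.
    by field; rewrite gt_eqF.
  by lra.
have := @ler_sum _ _ (index_enum 'I_N) xpredT _ _ (fun i _ => amgm i).
move=> /le_trans; apply.
rewrite -mulr_sumr ler_pM2l ?invr_gt0// big_split/= -!mulr_sumr lerD//.
  by rewrite ler_pM2l// wp// => n; exact: sqr_ge0.
by rewrite mulrC ler_pdivrMr// mulrC wq// => n; exact: sqr_ge0.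
Qed.

End nonneg_series.

(** * Construction of the weights and the frame bounds *)

Section weights.
Context {R : realType} {k : scalar_kind}.
Local Notation K := (scalars R k).
Context {H : completeNormedModType K} {ip : {dot H for sconj R k}}.
Hypothesis hH : hilbert ip.
Implicit Types (f g : nat -> H) (w : nat -> R) (x y : H).

Lemma coef_energy_weighted w f x : (forall n, 0 < w n) ->
  coef_energy ip (weighted w f) x =
  (\sum_(0 <= n <oo) ((w n * modulus (ip x (f n))) ^+ 2)%:E)%E.
Proof.
move=> w0; apply: eq_eseriesr => n _.
by rewrite ipZr sconj_of_real modulusM modulus_of_real// ltW.
Qed.

Lemma exists_bessel_weights f :
  exists w, (forall n, 0 < w n) /\ bessel ip (weighted w f).
Proof.
pose w n : R := 2^-1 ^+ n / (1 + rnorm (f n)).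
have f1 n : 0 < 1 + rnorm (f n) by rewrite ltr_pwDl ?rnorm_ge0.
have w0 n : 0 < w n by rewrite divr_gt0// exprn_gt0 ?invr_gt0.
exists w; split=> //; exists 2; split=> // x.
rewrite coef_energy_weighted//.
apply/nneseries_fin_le => [n|N]; first exact: sqr_ge0.
(* The constant 2 is sharpened to the partial sum of the geometric series so that induction on [N]
   applies. *)
apply: (@le_trans _ _ ((2 - 2^-1 ^+ N * 2) * rnorm x ^+ 2)); last first.
  by rewrite ler_wpM2r ?sqr_ge0// gerBl mulr_ge0// exprn_ge0 ?invr_ge0.
elim: N => [|N IH]; first by rewrite big_ord0 expr0 mul1r subrr mul0r.
rewrite big_ord_recr/=.
have : (w N * modulus (ip x (f N))) ^+ 2 <= 2^-1 ^+ N * rnorm x ^+ 2.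
  have h : w N * modulus (ip x (f N)) <= 2^-1 ^+ N * rnorm x.
    rewrite /w -mulrA ler_wpM2l ?exprn_ge0 ?invr_ge0// mulrC ler_pdivrMr//.
    apply: le_trans (cauchy_schwarz hH _ _) _.
    by rewrite ler_wpM2l ?rnorm_ge0// lerDr.
  apply: (@le_trans _ _ ((2^-1 ^+ N * rnorm x) ^+ 2)).
    have wx : 0 <= w N * modulus (ip x (f N)).
      by rewrite mulr_ge0 ?modulus_ge0 ?(ltW (w0 N)).
    by rewrite ler_sqr ?nnegrE// (le_trans wx).
  rewrite exprMn ler_wpM2r ?sqr_ge0// expr2.
  rewrite ler_piMl ?exprn_ge0 ?invr_ge0//.
  by rewrite exprn_ile1 ?invr_ge0// invf_le1// ler1n.
rewrite (exprSr _ N); move: IH; move: (2^-1 ^+ N) => q.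
by set S := \sum_(i < N) _; lra.
Qed.

Lemma complete_weighted w f : (forall n, 0 < w n) ->
  (forall x, (forall n, ip x (f n) = 0) -> x = 0) ->
  complete_seq (weighted w f).
Proof.
move=> w0 ftot; apply: (complete_seq_total hH) => x xf; apply: ftot => n.
have := xf n; rewrite ipZr sconj_of_real => /eqP.
rewrite mulf_eq0 => /orP[|/eqP//].
by rewrite gt_eqF// of_real_gt0.
Qed.

(** The energy is quadratic in the weights, so the common factor [Num.sqrt (A / A')] turns the bound
    [A'] into [A]. *)
Lemma lower_semi_frame_rescale (A : R) w f : 0 < A -> (forall n, 0 < w n) ->
  lower_semi_frame ip (weighted w f) ->
  exists w', (forall n, 0 < w' n) /\
    lower_semi_frame_with_bound ip A (weighted w' f).
Proof.
move=> A0 w0 [A' [A'0 wf]].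
have c0 : 0 < Num.sqrt (A / A') by rewrite sqrtr_gt0 divr_gt0.
have w'0 n : 0 < Num.sqrt (A / A') * w n by rewrite mulr_gt0.
exists (fun n => Num.sqrt (A / A') * w n); split=> //; split=> // x.
have := wf x; rewrite !coef_energy_weighted//.
have -> : (\sum_(0 <= n <oo)
    ((Num.sqrt (A / A') * w n * modulus (ip x (f n))) ^+ 2)%:E =
    (A / A')%:E * \sum_(0 <= n <oo) ((w n * modulus (ip x (f n))) ^+ 2)%:E)%E.
  rewrite -nneseriesZl; last by move=> n _; rewrite lee_fin sqr_ge0.
  apply: eq_eseriesr => n _; rewrite -EFinM -mulrA exprMn sqr_sqrtr//.
  by rewrite ltW// divr_gt0.
have AA'0 : (0 <= (A / A')%:E)%E by rewrite lee_fin ltW// divr_gt0.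
move=> /(lee_wpmul2l AA'0); apply: le_trans.
by rewrite -EFinM [A / A' * _]mulrA divfK ?gt_eqF.
Qed.

Lemma reproducing_pair_weights f g : reproducing_pair ip f g ->
  exists lambda beta : nat -> R,
    [/\ forall n, 0 < lambda n,
        forall n, 0 < beta n,
        lower_semi_frame ip (weighted (fun n => (lambda n)^-1) f) /\
        lower_semi_frame ip (weighted (fun n => (beta n)^-1) g)
      & upper_semi_frame ip (weighted lambda g) /\
        upper_semi_frame ip (weighted beta f)].
Proof.
move=> [T [TE [M TM] Tbij]].
have [C C0 TC] := bijective_bounded_below hH _ _ TM Tbij.
have [S TS ST] := Tbij.
have [la [la0 [B1 [B10 laB]]]] := exists_bessel_weights g.
have [be [be0 [B2 [B20 beB]]]] := exists_bessel_weights f.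
have iv0 w : (forall n, 0 < w n) -> forall n, 0 < (w n)^-1.
  by move=> w0 n; rewrite invr_gt0.
have T0 x : (forall y, ip (T x) y = 0) -> x = 0.
  move=> h; apply: (can_inj TS); rewrite linear0; apply: (ip_ext hH) => y.
  by rewrite ip0r ipC h rmorph0.
have partial x y e : 0 < e -> exists N, modulus (ip (T x) y) <=
    \sum_(i < N) modulus (ip x (f i)) * modulus (ip y (g i)) + e.
  move=> e0; have [N NP] := scalar_seriesP _ _ (TE x y) e e0.
  exists N; have := NP N (leqnn _); rewrite -modulusN opprB => h.
  rewrite -[ip (T x) y](subrK (\sum_(i < N) ip x (f i) * ip (g i) y)) addrC.
  apply: le_trans (modulusD _ _) _; apply: lerD; last exact: ltW.
  elim: (N) => [|n IH]; first by rewrite !big_ord0 modulus0.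
  rewrite !big_ord_recr/=; apply: le_trans (modulusD _ _) _.
  by rewrite lerD// modulusM (modulus_ipC (g n)).
have series0 x y : (forall n, ip x (f n) * ip (g n) y = 0) -> ip (T x) y = 0.
  move=> h; apply/modulus_eq0/eqP; rewrite eq_le modulus_ge0 andbT.
  apply/ler_addgt0Pr => e /(scalar_seriesP _ _ (TE x y) e)[N NP].
  have := NP N (leqnn _); rewrite big1 ?sub0r ?modulusN ?add0r; last by move=> i _.
  exact: ltW.
(* Totality of [f] uses the injectivity of [T], and totality of [g] its surjectivity. *)
have ftot x : (forall n, ip x (f n) = 0) -> x = 0.
  by move=> xf; apply: T0 => y; apply: series0 => n; rewrite xf mul0r.
have gtot y : (forall n, ip y (g n) = 0) -> y = 0.
  move=> yg; apply: (ip_ext hH) => x; rewrite ip0r -(ST x); apply: series0 => n.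
  by rewrite [ip (g n) y]ipC yg rmorph0 mulr0.
have ipxx_modulus x : modulus (ip x x) = rnorm x ^+ 2.
  by rewrite (ipxx hH) modulus_of_real ?sqr_ge0.
exists la, be; split=> //; split.
(* Duality with [l = rnorm (T x) ^+ 2] and [D = B1] gives the factor [B1^-1]; the lower bound on [T]
   gives [C ^- 2]. *)
- exists (B1^-1 * C ^- 2); split; first by rewrite mulr_gt0 ?invr_gt0 ?exprn_gt0.
  move=> x; rewrite coef_energy_weighted; last exact: iv0.
  have := laB (T x); rewrite coef_energy_weighted//.
  rewrite -ipxx_modulus => /(weighted_duality _ _ _ _ _ la0 B10).
  move=> /(_ (fun n => modulus (ip x (f n))) (partial x (T x))).
  apply: le_trans; rewrite lee_fin -mulrA ler_wpM2l ?invr_ge0 ?(ltW B10)//.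
  rewrite ipxx_modulus mulrC ler_pdivrMr ?exprn_gt0// mulrC -exprMn.
  by rewrite ler_sqr ?nnegrE ?mulr_ge0 ?rnorm_ge0 ?(ltW C0).
(* Here [l = rnorm y ^+ 2] with [y = T (S y)]. The Bessel bound at [S y] is at most
   [B2 * C ^+ 2 * l], which dictates [D]. *)
- exists (B2 * C ^+ 2)^-1; split; first by rewrite invr_gt0 mulr_gt0 ?exprn_gt0.
  move=> y; rewrite coef_energy_weighted; last exact: iv0.
  rewrite -ipxx_modulus.
  apply: (weighted_duality (fun n => modulus (ip y (g n)))
    (fun n => modulus (ip (S y) (f n)))) => //.
  + by rewrite mulr_gt0 ?exprn_gt0.
  + move=> e /(partial (S y) y)[N NP]; exists N; rewrite ST in NP.
    by under eq_bigr do rewrite mulrC.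
  have := beB (S y); rewrite coef_energy_weighted// => /le_trans; apply.
  rewrite lee_fin -mulrA ler_wpM2l ?(ltW B20)// ipxx_modulus -exprMn.
  rewrite ler_sqr ?nnegrE ?mulr_ge0 ?rnorm_ge0 ?(ltW C0)//.
  by have := TC (S y); rewrite ST.
- by split; [exists B1|exact: complete_weighted].
- by split; [exists B2|exact: complete_weighted].
Qed.

End weights.

Theorem proposition3p3 (R : realType) (k : scalar_kind)
    (H : completeNormedModType (scalars R k)) (ip : {dot H for sconj R k})
    (hH : hilbert ip) (hsep : separable H) (hinf : infinite_dimensional H)
    (f g : nat -> H) (hfg : reproducing_pair ip f g) :
  (exists lambda beta : nat -> R,
     [/\ forall n, 0 < lambda n,
         forall n, 0 < beta n,
         lower_semi_frame ip (weighted (fun n => (lambda n)^-1) f) /\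
         lower_semi_frame ip (weighted (fun n => (beta n)^-1) g)
       & upper_semi_frame ip (weighted lambda g) /\
         upper_semi_frame ip (weighted beta f)])
  /\
  (forall A : R, 0 < A ->
     exists omega omega' : nat -> R,
       [/\ forall n, 0 < omega n,
           forall n, 0 < omega' n,
           lower_semi_frame_with_bound ip A (weighted omega f)
         & lower_semi_frame_with_bound ip A (weighted omega' g)]).
Proof.
have [la [be [la0 be0 [fl gl] up]]] := reproducing_pair_weights hH _ _ hfg.
split=> [|A A0]; first by exists la, be.
have iv0 (w : nat -> R) : (forall n, 0 < w n) -> forall n, 0 < (w n)^-1.
  by move=> w0 n; rewrite invr_gt0.
have [w [w0 wf]] := lower_semi_frame_rescale _ _ _ A0 (iv0 _ la0) fl.
have [w' [w'0 w'g]] := lower_semi_frame_rescale _ _ _ A0 (iv0 _ be0) gl.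
by exists w, w'.
Qed.
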